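(* Let $X$ be a set and let $a=x_{i_1}^{(k_1)}\cdots x_{i_{n-1}}^{(k_{n-1})}x_{i_n}^{(k_n)}$ (with $n\ge 1$, $x_{i_1},\dots,x_{i_n}\in X$, $k_1,\dots,k_n\ge 0$) be a monomial of $\mathrm{DerPerm}\langle X\rangle$. Then $a\in \mathrm{DerPerm}_{\succ}\langle X\rangle$ if and only if $\mathrm{wt}(a)=-1$ and $k_n=0$.
   Context: All algebras are over a fixed field $\mathbb K$. A perm algebra is an associative (not necessarily unital) algebra satisfying the left-commutative identity $abc=bac$. $\mathrm{DerPerm}\langle X\rangle$ is the free perm algebra with a derivation $d$ generated by the set $X$. As a perm algebra it is the free perm algebra on the set $X^{(\omega)}=X\cup X'\cup X''\cup\cdots$ of symbols $x^{(k)}=d^k(x)$, $x\in X$, $k\ge 0$ (with $x^{(0)}=x$, $x^{(1)}=x'$, $x^{(2)}=x''$), and $d(x^{(k)})=x^{(k+1)}$. A monomial is a product $x_{i_1}^{(k_1)}\cdots x_{i_n}^{(k_n)}$ of elements of $X^{(\omega)}$; two such products are equal exactly when they have the same last factor and their first $n-1$ factors agree up to permutation, and the distinct monomials form a linear basis. $\mathrm{DerPerm}_{\succ}\langle X\rangle$ is the subalgebra generated by $X$ of the space $\mathrm{DerPerm}\langle X\rangle$ equipped with the single bilinear operation $a\succ b=d(a)b$. The weight of a monomial is defined by $\mathrm{wt}(x^{(j)})=j-1$ for $x\in X$, $j\ge 0$, and $\mathrm{wt}(uv)=\mathrm{wt}(u)+\mathrm{wt}(v)$. *)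

(* Defs.v *)
From HB Require Import structures.
From mathcomp Require Import all_boot all_order all_algebra.

Set Implicit Arguments.
Unset Strict Implicit.
Unset Printing Implicit Defensive.

Import GRing.Theory.
Local Open Scope ring_scope.

(* Perm algebras need not be unital, so they cannot extend MathComp's rings. *)
HB.mixin Record Lmodule_isPermAlgebra (K : fieldType) V of GRing.Lmodule K V := {
  pmul : V -> V -> V;
  pmul_linearl : forall b, linear (pmul^~ b);
  pmul_linearr : forall a, linear (pmul a);
  pmulA : associative pmul;
  pmul_leftC : left_commutative pmul
}.

#[short(type="permAlgType")]
HB.structure Definition PermAlgebra (K : fieldType) :=
  {V of Lmodule_isPermAlgebra K V & GRing.Lmodule K V}.

HB.mixin Record PermAlgebra_hasDerivation (K : fieldType) V
    of PermAlgebra K V := {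
  der : V -> V;
  der_linear : linear der;
  der_pmul : forall a b : V, der (pmul a b) = pmul (der a) b + pmul a (der b)
}.

#[short(type="derPermAlgType")]
HB.structure Definition DerPermAlgebra (K : fieldType) :=
  {V of PermAlgebra_hasDerivation K V & PermAlgebra K V}.

Definition der_perm_morphism (K : fieldType) (A B : derPermAlgType K)
    (g : A -> B) : Prop :=
  [/\ linear g, {morph g : a b / pmul a b} & {morph g : a / der a}].

(* Universal property of DerPerm<X>; X is mapped into the algebra by iota. *)
Definition is_free_der_perm (K : fieldType) (X : Type) (A : derPermAlgType K)
    (iota : X -> A) : Prop :=
  forall (B : derPermAlgType K) (f : X -> B),
    exists g : A -> B,
      [/\ der_perm_morphism g, forall x, g (iota x) = f x
        & forall h : A -> B, der_perm_morphism h ->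
            (forall x, h (iota x) = f x) -> h =1 g].

Inductive generated_subalgebra (K : fieldType) (V : lmodType K)
    (op : V -> V -> V) (S : V -> Prop) : V -> Prop :=
  | gen_in a : S a -> generated_subalgebra op S a
  | gen_zero : generated_subalgebra op S 0
  | gen_add a b : generated_subalgebra op S a -> generated_subalgebra op S b ->
      generated_subalgebra op S (a + b)
  | gen_scale (c : K) a : generated_subalgebra op S a ->
      generated_subalgebra op S (c *: a)
  | gen_op a b : generated_subalgebra op S a -> generated_subalgebra op S b ->
      generated_subalgebra op S (op a b).

Definition succ_op (K : fieldType) (A : derPermAlgType K) (a b : A) : A :=
  pmul (der a) b.

Definition in_der_perm_succ (K : fieldType) (X : Type) (A : derPermAlgType K)
    (iota : X -> A) : A -> Prop :=
  generated_subalgebra (@succ_op K A) (fun a => exists x, a = iota x).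

(* The pair (x, k) : X * nat encodes the symbol x^(k) = d^k(x). *)
Definition letter (K : fieldType) (X : Type) (A : derPermAlgType K)
    (iota : X -> A) (y : X * nat) : A :=
  iter y.2 der (iota y.1).

(* A nonempty word is given by its first n-1 letters u and its last letter v. *)
Definition monomial (K : fieldType) (X : Type) (A : derPermAlgType K)
    (iota : X -> A) (u : seq (X * nat)) (v : X * nat) : A :=
  foldr (fun y a => pmul (letter iota y) a) (letter iota v) u.

Definition wt (X : Type) (u : seq (X * nat)) (v : X * nat) : int :=
  \sum_(y <- rcons u v) (y.2%:Z - 1).

(* Main.v *)
Require Import Defs.
From HB Require Import structures.
From mathcomp Require Import all_boot all_order all_algebra.
From mathcomp Require Import ring zify.

Set Implicit Arguments.
Unset Strict Implicit.
Unset Printing Implicit Defensive.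

Import GRing.Theory.
Local Open Scope ring_scope.

(** Write [a > b] for [d(a) b], and call a word balanced when the weights of
    its letters add up to 0. A monomial [u v] whose last letter [v] has order 0
    has weight -1 exactly when [u] is balanced ([wt_eqN1]).

    Balanced monomials are in the subalgebra, by induction on the length of
    [u]. If [u] is empty, the monomial is a generator. Otherwise [u] contains a
    letter [x^(k+1)] and, to compensate for its weight, letters [z_1], ...,
    [z_k] of order 0 ([balanced_word_split]). Since the letters before the last
    one commute, the monomial is [x^(k+1) z_1 ... z_k b] with [b] balanced.
    With [a = x^(k) z_1 ... z_k], the element [a > b] is this monomial plus the
    terms [x^(k) z_1 ... z_i' ... z_k b], each of which is [z_i > m] for a
    shorter balanced monomial [m]. All coefficients are 1, so the
    characteristic of the field does not matter.

    Conversely, freeness gives a morphism to any differential perm algebra, so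
    it suffices to find one in which both the subalgebra and the images of
    monomials are easy to describe. On [K[s, y, E]] take the product
    [a * b = E a(s, s, E) b] and the derivation [D = s E d/dE + y], and send
    every generator to 1; think of [E] as [exp (s t)]. The letter of order [k]
    becomes [y^k] in the last place and acts as multiplication by [s^k E] in
    the other ones, so a monomial [u v] becomes [s^p E^n y^q], where [p] is the
    sum of the orders of the letters of [u], [n] is their number and [q] is the
    order of [v] ([monomial_model]). No coefficient vanishes, again in every
    characteristic. On the other hand [K[sE]] contains 1 and is closed under
    the operation ([in_KsE_succ]), so an image in the subalgebra must have
    [p = n] and [q = 0] ([monomial_in_KsE]). *)

(** * Words and their weights *)

Section Words.

Variable X : Type.
Implicit Types (w u : seq (X * nat)) (v : X * nat).

Definition balanced_word w : bool := sumn (unzip2 w) == size w.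

Definition order0 : pred (X * nat) := fun y => y.2 == 0%N.

Lemma wtE u v :
  wt u v = (sumn (unzip2 u))%:Z - (size u)%:Z + (v.2%:Z - 1).
Proof.
rewrite /wt -cats1 big_cat big_seq1; congr (_ + _).
elim: u => [|y u IHu]; first by rewrite big_nil.
by rewrite big_cons IHu /=; lia.
Qed.

Lemma wt_eqN1 u v :
  wt u v = -1 /\ v.2 = 0%N <-> balanced_word u /\ v.2 = 0%N.
Proof.
by rewrite wtE /balanced_word; split=> -[h v0]; move: h; rewrite v0; split; lia.
Qed.

Lemma sumn_unzip2_cat u w :
  sumn (unzip2 (u ++ w)) = (sumn (unzip2 u) + sumn (unzip2 w))%N.
Proof. by rewrite /unzip2 map_cat sumn_cat. Qed.

Lemma sumn_unzip2_filter (p : pred (X * nat)) w :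
  (sumn (unzip2 (filter p w)) + sumn (unzip2 (filter (predC p) w)))%N
    = sumn (unzip2 w).
Proof. by elim: w => //= y w IHw; case: (p y) => /=; lia. Qed.

Lemma sumn_unzip2_order0 w : all order0 w -> sumn (unzip2 w) = 0%N.
Proof. by elim: w => //= -[x k] w IHw /andP[/eqP /= -> /IHw]. Qed.

Lemma size_le_sumn_unzip2 w :
  all (predC order0) w -> (size w <= sumn (unzip2 w))%N.
Proof. by elim: w => //= -[x [|k]] w IHw //= /IHw; lia. Qed.

(** The weights of a balanced word add up to zero, so the weight [k] of a
    letter of order [k.+1] has to be compensated by letters of weight [-1],
    that is, by at least [k] letters of order zero. *)
Lemma balanced_word_split w : balanced_word w -> w <> [::] ->
  exists x k N Z1 Z2,
    [/\ filter (predC order0) w = (x, k.+1) :: N,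
        filter order0 w = Z1 ++ Z2, size Z1 = k, all order0 Z1
      & balanced_word (Z2 ++ N)].
Proof.
move=> /eqP bal w_neq0.
have sizeE : (size (filter order0 w) + size (filter (predC order0) w) = size w)%N.
  by rewrite !size_filter count_predC.
have sumE := sumn_unzip2_filter order0 w.
have allZ : all order0 (filter order0 w) by apply: filter_all.
have := filter_all (predC order0) w.
have sumZ := sumn_unzip2_order0 allZ.
case: (filter (predC order0) w) sizeE sumE => [|[x [|k]] N] //= sizeE sumE.
  by case: w_neq0; apply: size0nil; lia.
move=> /size_le_sumn_unzip2 leN.
have le_kZ : (k <= size (filter order0 w))%N by lia.
exists x, k, N, (take k (filter order0 w)), (drop k (filter order0 w)).
have := sumZ; have := allZ; rewrite -{1 2}(cat_take_drop k (filter _ w)).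
rewrite all_cat sumn_unzip2_cat => /andP[Z1_0 _] sumZ12.
split=> //; rewrite ?cat_take_drop ?size_takel //.
rewrite /balanced_word size_cat size_drop sumn_unzip2_cat; lia.
Qed.

End Words.

(** * Balanced monomials belong to the subalgebra *)

Section Monomials.

Variables (K : fieldType) (X : Type) (A : derPermAlgType K) (iota : X -> A).
Implicit Types (w u : seq (X * nat)) (v : X * nat).

Notation mono := (monomial iota).

Lemma pmul_monomial u z w v :
  pmul (mono u z) (mono w v) = mono (u ++ z :: w) v.
Proof. by elim: u => //= y u <-; rewrite pmulA. Qed.

Lemma monomial_cat_cons u y w v :
  mono (u ++ y :: w) v = pmul (letter iota y) (mono (u ++ w) v).
Proof. by elim: u => //= z u ->; rewrite pmul_leftC. Qed.

(** Filtering stands for permuting the word: it needs no decidable equality on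
    [X]. *)
Lemma monomial_filter p w v :
  mono w v = mono (filter p w ++ filter (predC p) w) v.
Proof.
elim: w => //= y w IHw; case: (p y) => /=; first by rewrite -IHw.
by rewrite monomial_cat_cons -IHw.
Qed.

Lemma pmulDl (a b c : A) : pmul (a + b) c = pmul a c + pmul b c.
Proof. by have := pmul_linearl c 1 a b; rewrite !scale1r. Qed.

Lemma in_der_perm_succB (a b : A) : in_der_perm_succ iota a ->
  in_der_perm_succ iota b -> in_der_perm_succ iota (a - b).
Proof.
by move=> ha hb; rewrite -scaleN1r; apply: gen_add => //; apply: gen_scale.
Qed.

(** Expanding [der] by the Leibniz rule turns one letter [y] of order zero at a
    time into [y'], and [y' m = y > m] reduces each summand to the balanced
    monomial [m], which has one letter less. *)
Lemma pmul_der_monomial_in_der_perm_succ n u z w v :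
    (forall t, (size t < n)%N -> balanced_word t ->
       in_der_perm_succ iota (mono t v)) ->
    all (@order0 X) u -> z.2 = 0%N -> (size u + size w < n)%N ->
    sumn (unzip2 w) = (size u + size w)%N ->
  in_der_perm_succ iota (pmul (der (mono u z)) (mono w v)).
Proof.
move=> IHn; elim: u w => [|[x j] u IHu] w /=.
  case: z => x j _ /= -> lt_n sumw; apply: gen_op; first by apply: gen_in; exists x.
  by apply: IHn => //; apply/eqP.
move=> /andP[/eqP /= -> u0] z0 lt_n sumw.
rewrite der_pmul pmulDl; apply: gen_add.
  rewrite -pmulA pmul_monomial; apply: gen_op; first by apply: gen_in; exists x.
  apply: IHn; first by rewrite size_cat /=; lia.
  rewrite /balanced_word sumn_unzip2_cat size_cat /= z0 sumw.
  by rewrite sumn_unzip2_order0 //; lia.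
rewrite -pmulA pmul_leftC -[pmul _ (mono w v)]/(mono ((x, 0%N) :: w) v).
by apply: IHu => //=; lia.
Qed.

(** With the letters of order zero that compensate for [x^(k+1)], the monomial
    [a = x^(k) z_1 ... z_k] is balanced, and so is the monomial [b] of the
    remaining letters. The Leibniz rule gives
    [a > b = x^(k+1) z_1 ... z_k b + ...], where in the other summands the
    derivative falls on some [z_i]. *)
Lemma balanced_monomial_in_der_perm_succ u v :
  balanced_word u -> v.2 = 0%N -> in_der_perm_succ iota (mono u v).
Proof.
have [n le_un] := ubnP (size u).
elim: n u v le_un => // n IHn u v; rewrite ltnS => le_un bal v0.
have [u_nil | u_cons] : u = [::] \/ u <> [::] by case: (u); [left | right].
  by apply: gen_in; exists v.1; rewrite u_nil /= /letter v0.
have := size_filter (@order0 X) u; have := size_filter (predC (@order0 X)) u.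
have := count_predC (@order0 X) u.
have [x [k [N [Z1 [Z2 [NE ZE]]]]]] := balanced_word_split bal u_cons.
rewrite (monomial_filter (@order0 X)) NE ZE size_cat /=.
case: (lastP Z1) => [<- _ bal2 | U z].
  move=> count_u sizeN sizeZ.
  rewrite monomial_cat_cons /=; apply: gen_op; first by apply: gen_in; exists x.
  by apply: IHn => //; rewrite size_cat; lia.
rewrite size_rcons all_rcons => <- /andP[/eqP z0 U0] bal2 count_u sizeN sizeZ.
rewrite monomial_cat_cons -catA cat_rcons -pmul_monomial.
(* [z] plays the part of the last letter [z_k] of [a]. *)
have -> : pmul (letter iota (x, (size U).+2)) (pmul (mono U z) (mono (Z2 ++ N) v))
    = succ_op (mono ((x, (size U).+1) :: U) z) (mono (Z2 ++ N) v)
      - pmul (der (mono U z)) (mono ((x, (size U).+1) :: Z2 ++ N) v).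
  rewrite /succ_op /= der_pmul pmulDl -!pmulA.
  by rewrite (pmul_leftC (letter _ _) (der _)) addrK.
have sum_bal2 := eqP bal2.
apply: in_der_perm_succB.
  apply: gen_op; apply: IHn => //; rewrite ?size_cat /=; try lia.
  by rewrite /balanced_word /= sumn_unzip2_order0 //; lia.
apply: (@pmul_der_monomial_in_der_perm_succ n) => //=.
    by move=> t lt_tn bal_t; apply: IHn.
  by rewrite size_cat; lia.
by rewrite sum_bal2; lia.
Qed.

End Monomials.

(** * A differential perm algebra that detects the weight *)

Section Model.

Variable K : fieldType.

(** The ring [K[s, y, E]], with [E] the outermost variable so that [d/dE] is
    the formal derivative and the substitution [y := s] is a map on
    coefficients. *)
Definition model := {poly {poly {poly K}}}.

HB.instance Definition _ := GRing.Zmodule.on model.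

Definition model_const (c : K) : model := c%:P%:P%:P.
Definition model_scale (c : K) (a : model) : model := model_const c * a.

Fact model_scaleA c d a :
  model_scale c (model_scale d a) = model_scale (c * d) a.
Proof. by rewrite /model_scale /model_const !polyCM mulrA. Qed.

Fact model_scale1 : left_id 1 model_scale.
Proof. by move=> a; rewrite /model_scale /model_const !polyC1 mul1r. Qed.

Fact model_scaleDr : right_distributive model_scale +%R.
Proof. by move=> c a b; rewrite /model_scale mulrDr. Qed.

Fact model_scaleDl a : {morph model_scale^~ a : c d / c + d}.
Proof. by move=> c d; rewrite /model_scale /model_const !polyCD mulrDl. Qed.

HB.instance Definition _ :=
  GRing.Zmodule_isLmodule.Build K model
    model_scaleA model_scale1 model_scaleDr model_scaleDl.

Local Notation s := ('X%:P%:P : {poly {poly {poly K}}}).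
Local Notation y := ('X%:P : {poly {poly {poly K}}}).
Local Notation E := ('X : {poly {poly {poly K}}}).

Definition y_to_s : {poly {poly K}} -> {poly {poly K}} := polyC \o horner_eval 'X.
HB.instance Definition _ := GRing.RMorphism.on y_to_s.

Notation sigma := (map_poly y_to_s).

(** A perm product, because [sigma] is an idempotent ring morphism that fixes
    [E]. *)
Definition model_mul (a b : model) : model := E * sigma a * b.

(** The Leibniz rule holds because [sigma] commutes with [d/dE] and sends the
    multiplier [y] of the last factor to the [s] that comes from [d/dE] of the
    factor [E] in the product. *)
Definition model_der (a : model) : model := s * E * a^`() + y * a.

Lemma y_to_sC p : y_to_s p%:P = p%:P.
Proof. by rewrite /y_to_s /= /horner_eval hornerC. Qed.

Lemma sigmaK a : sigma (sigma a) = sigma a.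
Proof.
by rewrite -map_poly_comp; apply: eq_map_poly => p /=; rewrite y_to_sC.
Qed.

Lemma sigmaE : (sigma E = E) * (sigma s = s) * (sigma y = s)
  * (forall c, sigma (model_const c) = model_const c).
Proof.
do ![split] => *; rewrite ?map_polyX // !map_polyC /= ?y_to_sC //.
by rewrite /y_to_s /= /horner_eval hornerX.
Qed.

Fact model_mul_linearl b : linear (model_mul^~ b).
Proof.
move=> c a1 a2; rewrite /model_mul /GRing.scale /= /model_scale.
by rewrite rmorphD rmorphM /= sigmaE; ring.
Qed.

Fact model_mul_linearr a : linear (model_mul a).
Proof.
move=> c b1 b2; rewrite /model_mul /GRing.scale /= /model_scale.
by ring.
Qed.

Fact model_mulA : associative model_mul.
Proof.
by move=> a b c; rewrite /model_mul !rmorphM /= sigmaK !sigmaE; ring.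
Qed.

Fact model_mul_leftC : left_commutative model_mul.
Proof. by move=> a b c; rewrite /model_mul; ring. Qed.

HB.instance Definition _ := Lmodule_isPermAlgebra.Build K model
  model_mul_linearl model_mul_linearr model_mulA model_mul_leftC.

Fact model_der_linear : linear model_der.
Proof.
move=> c a1 a2; rewrite /model_der /GRing.scale /= /model_scale.
by rewrite derivD /model_const derivM derivC; ring.
Qed.

Fact model_der_mul (a b : model) :
  model_der (pmul a b) = pmul (model_der a) b + pmul a (model_der b).
Proof.
rewrite /pmul /= /model_mul /model_der !derivM derivX rmorphD !rmorphM /=.
by rewrite !sigmaE -deriv_map; ring.
Qed.

HB.instance Definition _ := PermAlgebra_hasDerivation.Build K model
  model_der_linear model_der_mul.

(** Membership in [K[sE]], read off the coefficients in [E]. *)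
Definition in_KsE (a : model) : Prop :=
  forall n, exists c : K, a`_n = (c *: 'X^n)%:P.

Lemma in_KsE0 : in_KsE 0.
Proof. by move=> n; exists 0; rewrite coef0 scale0r. Qed.

Lemma in_KsE1 : in_KsE 1.
Proof.
move=> n; rewrite coef1; case: n => [|n]; last by exists 0; rewrite scale0r.
by exists 1; rewrite expr0 scale1r.
Qed.

Lemma in_KsED a b : in_KsE a -> in_KsE b -> in_KsE (a + b).
Proof.
move=> ha hb n; have [[c ac] [d bd]] := (ha n, hb n).
by exists (c + d); rewrite coefD ac bd scalerDl polyCD.
Qed.

Lemma in_KsEM a b : in_KsE a -> in_KsE b -> in_KsE (a * b : {poly _}).
Proof.
move=> ha hb n; rewrite coefM.
elim/big_ind: _ => [|p q [c ->] [d ->]|i _].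
- by exists 0; rewrite scale0r.
- by exists (c + d); rewrite scalerDl polyCD.
have [[c ->] [d ->]] := (ha i, hb (n - i)%N); exists (c * d).
by rewrite -polyCM -scalerAl -scalerAr scalerA -exprD subnKC // -ltnS.
Qed.

Lemma in_KsE_const c : in_KsE (model_const c).
Proof.
move=> n; rewrite coefC; case: n => [|n]; last by exists 0; rewrite scale0r.
by exists c; rewrite expr0 alg_polyC.
Qed.

Lemma in_KsE_sE : in_KsE (s * E).
Proof.
move=> n; rewrite coefMX coefC; case: n => [|[|n]] /=.
- by exists 0; rewrite scale0r.
- by exists 1; rewrite scale1r.
- by exists 0; rewrite scale0r.
Qed.

Lemma in_KsE_Euler a : in_KsE a -> in_KsE (E * a^`()).
Proof.
move=> ha n; have [c ac] := ha n; exists (c *+ n); rewrite coefXM coef_deriv.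
case: n c ac => [|n] c ac /=; first by rewrite mulr0n scale0r.
by rewrite ac -scalerMnl polyCMn.
Qed.

Lemma sigma_in_KsE a : in_KsE a -> sigma a = a.
Proof.
by move=> ha; apply/polyP=> n; have [c ac] := ha n; rewrite coef_map ac /= y_to_sC.
Qed.

(** Elements of [K[sE]] do not involve [y], so they are fixed by [sigma], and
    [a > b] becomes [sE (E da/dE + a) b]; the Euler operator [E d/dE] preserves
    [K[sE]]. *)
Lemma in_KsE_succ (a b : model) : in_KsE a -> in_KsE b -> in_KsE (succ_op a b).
Proof.
move=> ha hb; have sigma_a := sigma_in_KsE ha.
have -> : succ_op a b = s * E * (E * a^`() + a) * b.
  rewrite /succ_op /pmul /= /model_mul /der /= /model_der.
  by rewrite rmorphD !rmorphM /= !sigmaE -deriv_map sigma_a; ring.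
apply: in_KsEM => //; apply: in_KsEM; first exact: in_KsE_sE.
by apply: in_KsED => //; apply: in_KsE_Euler.
Qed.

Lemma in_der_perm_succ_KsE (X : Type) (a : model) :
  in_der_perm_succ (fun _ : X => 1 : model) a -> in_KsE a.
Proof.
elim=> {a} [a [_ ->]||a b _ ha _ hb|c a _ ha|a b _ ha _ hb].
- exact: in_KsE1.
- exact: in_KsE0.
- exact: in_KsED.
- by apply: in_KsEM => //; apply: in_KsE_const.
- exact: in_KsE_succ.
Qed.

Lemma letter_model (X : Type) (l : X * nat) :
  letter (fun _ : X => 1 : model) l = y ^+ l.2.
Proof.
case: l => x k; rewrite /letter /=; elim: k => //= k ->.
by rewrite /der /= /model_der -polyC_exp derivC mulr0 add0r polyC_exp exprS.
Qed.

Lemma monomial_model (X : Type) (u : seq (X * nat)) (v : X * nat) :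
  monomial (fun _ : X => 1 : model) u v
    = ('X ^+ v.2 * ('X ^+ sumn (unzip2 u))%:P)%:P * 'X ^+ size u.
Proof.
elim: u => [|l u IHu] /=.
  by rewrite letter_model expr0 !polyC1 !mulr1 -polyC_exp.
rewrite letter_model IHu /pmul /= /model_mul rmorphXn /= sigmaE.
by rewrite !polyCM !polyC_exp exprD exprS; ring.
Qed.

(** Compare the coefficients of [E^n] in [s^p E^n y^q], where it is [s^p y^q],
    and in an element of [K[sE]], where it is a multiple of [s^n]. *)
Lemma monomial_in_KsE (X : Type) (u : seq (X * nat)) (v : X * nat) :
  in_KsE (monomial (fun _ : X => 1 : model) u v) ->
  balanced_word u /\ v.2 = 0%N.
Proof.
move=> /(_ (size u)) [c]; rewrite monomial_model coefMXn ltnn subnn coefC /= => eq_c.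
have v0 : v.2 = 0%N.
  have := congr1 (fun p : {poly {poly K}} => p`_(v.2)) eq_c.
  rewrite /= coefXnM ltnn subnn !coefC /=; case: (v.2) => // n /eqP.
  by rewrite expf_eq0 polyX_eq0 andbF.
split=> //; move: eq_c; rewrite v0 mul1r => /polyC_inj.
move=> /(congr1 (fun p : {poly K} => p`_(sumn (unzip2 u)))).
rewrite /= coefZ !coefXn eqxx /balanced_word; case: eqP => // _ /eqP.
by rewrite mulr0 oner_eq0.
Qed.

End Model.

(** * Transport along morphisms, and the criterion *)

Section Morphisms.

Variables (K : fieldType) (X : Type) (A B : derPermAlgType K).
Variables (iota : X -> A) (f : X -> B) (g : A -> B).
Hypotheses (g_mor : der_perm_morphism g) (g_iota : forall x, g (iota x) = f x).

Lemma morphism_monomial u v : g (monomial iota u v) = monomial f u v.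
Proof.
have [_ gM gd] := g_mor.
have g_letter l : g (letter iota l) = letter f l.
  by case: l => x k; rewrite /letter /=; elim: k => //= k <-.
by elim: u => //= l u IHu; rewrite gM g_letter IHu.
Qed.

Lemma morphism_in_der_perm_succ a :
  in_der_perm_succ iota a -> in_der_perm_succ f (g a).
Proof.
have [g_lin gM gd] := g_mor.
have gD b c : g (b + c) = g b + g c by have := g_lin 1 b c; rewrite !scale1r.
have g0 : g 0 = 0 by apply: (addrI (g 0)); rewrite -gD !addr0.
have gZ c b : g (c *: b) = c *: g b by have := g_lin c b 0; rewrite g0 !addr0.
elim=> {a} [a [x ->]||a b _ ha _ hb|c a _ ha|a b _ ha _ hb].
- by apply: gen_in; exists x.
- by rewrite g0; apply: gen_zero.
- by rewrite gD; apply: gen_add.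
- by rewrite gZ; apply: gen_scale.
- by rewrite /succ_op gM gd; apply: gen_op.
Qed.

End Morphisms.

Theorem theorem1 (K : fieldType) (X : Type) (A : derPermAlgType K)
    (iota : X -> A) (A_free : is_free_der_perm iota)
    (u : seq (X * nat)) (xn : X) (kn : nat) :
  in_der_perm_succ iota (monomial iota u (xn, kn)) <->
  wt u (xn, kn) = -1 /\ kn = 0%N.
Proof.
rewrite (wt_eqN1 u (xn, kn)); split=> [in_succ | [bal kn0]]; last first.
  exact: balanced_monomial_in_der_perm_succ.
have [g [g_mor g_iota _]] := A_free (model K) (fun _ => 1 : model K).
have := morphism_in_der_perm_succ g_mor g_iota in_succ.
rewrite (morphism_monomial g_mor g_iota) => /in_der_perm_succ_KsE.
exact: monomial_in_KsE.
Qed.
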